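(* Let $\mathcal A$ be a unital C$^*$-algebra, $\mathcal H=\{h\in\mathcal A: Im(h)\text{ is positive and invertible}\}$ and $\mathcal D=\{z\in\mathcal A:\|z\|<1\}$. The map $\Gamma:\mathcal H\to\mathcal D$, $$\Gamma(h)=(1+ih)(1-ih)^{-1},$$ is a (well defined) diffeomorphism with inverse $\Gamma^{-1}:\mathcal D\to\mathcal H$, $$\Gamma^{-1}(z)=i(1-z)(1+z)^{-1}.$$
   Context: $Im(h)=\frac1{2i}(h-h^* )$. Both $\mathcal H$ and $\mathcal D$ are open subsets of the Banach space $\mathcal A$; diffeomorphism means $C^\infty$ diffeomorphism. *)

(* Defs.v *)
From HB Require Import structures.
From mathcomp Require Import all_boot all_order all_algebra complex.
From mathcomp Require Import all_classical all_reals all_analysis.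

Set Implicit Arguments.
Unset Strict Implicit.
Unset Printing Implicit Defensive.

Import Order.TTheory GRing.Theory Num.Theory.
Import numFieldNormedType.Exports.

Local Open Scope classical_set_scope.
Local Open Scope ring_scope.
Local Open Scope complex_scope.

Section ContinuousLinearMaps.
Variables (R : realType) (V W : normedModType R).

Definition is_clin : pred (V -> W) := fun f => `[< linear f /\ continuous f >].

Record clin : Type := CLin { clin_fun :> V -> W ; _ : is_clin clin_fun }.

HB.instance Definition _ := [isSub for clin_fun].
HB.instance Definition _ := [Choice of clin by <:].

Fact is_clin_submod_closed : submod_closed is_clin.
Proof.
split=> [|a f g /asboolP[lf cf] /asboolP[lg cg]]; apply/asboolP; split.
- by move=> k u v /=; rewrite scaler0 addr0.
- exact: cst_continuous.
- move=> k u v.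
  rewrite -[LHS]/(a *: f (k *: u + v) + g (k *: u + v)).
  rewrite -[RHS]/(k *: (a *: f u + g u) + (a *: f v + g v)).
  by rewrite lf lg !scalerDr !scalerA [k * a]mulrC addrACA.
- by move=> x; apply: cvgD; [apply: cvgZr; exact: cf|exact: cg].
Qed.

HB.instance Definition _ :=
  GRing.isSubmodClosed.Build R (V -> W) is_clin is_clin_submod_closed.
HB.instance Definition _ := [SubChoice_isSubLmodule of clin by <:].

Definition opnorm (f : clin) : R := sup [set `|f x| | x in [set x | `|x| <= 1]].

Lemma clin_linear (f : clin) : linear f.
Proof. by case: f => f /= /asboolP[]. Qed.

Lemma clin_continuous (f : clin) : continuous f.
Proof. by case: f => f /= /asboolP[]. Qed.

Lemma clin_bounded (f : clin) : exists M, forall x, `|f x| <= M * `|x|.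
Proof.
pose g : {linear V -> W} := HB.pack (f : V -> W)
  (GRing.isLinear.Build R V W _ (f : V -> W) (@clin_linear f)).
have /linear_boundedP[M [_ /(_ (M + 1))]] : bounded_near g (nbhs (0 : V)).
  by apply: continuous_linear_bounded; exact: (@clin_continuous f).
by rewrite ltrDl ltr01 => /(_ isT) gM; exists (M + 1).
Qed.

Lemma opnorm_has_sup (f : clin) :
  has_sup [set `|f x| | x in [set x | `|x| <= 1]].
Proof.
split; first by exists `|f 0|, 0 => //=; rewrite normr0 ler01.
have [M fM] := clin_bounded f; exists (`|M|) => _ [x /= x1 <-].
apply: (le_trans (fM x)); apply: (le_trans (ler_norm _)).
by rewrite normrM normr_id ler_piMr.
Qed.

Lemma ler_opnorm1 (f : clin) (x : V) : `|x| <= 1 -> `|f x| <= opnorm f.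
Proof.
by move=> x1; apply: sup_upper_bound; [exact: opnorm_has_sup|exists x].
Qed.

Lemma opnorm_ge0 (f : clin) : 0 <= opnorm f.
Proof. by apply: le_trans (ler_opnorm1 f (x := 0) _); rewrite ?normr0. Qed.

Lemma opnorm_le (f : clin) (M : R) :
  (forall x, `|x| <= 1 -> `|f x| <= M) -> opnorm f <= M.
Proof.
move=> fM; apply: ge_sup; first by case: (opnorm_has_sup f).
by move=> _ [x /= x1 <-]; exact: fM.
Qed.

Lemma clinZ (f : clin) (k : R) (x : V) : f (k *: x) = k *: f x.
Proof.
have f0 : f 0 = 0.
  have := @clin_linear f (-1) 0 0.
  by rewrite scaler0 addr0 scaleN1r addNr.
by have := @clin_linear f k x 0; rewrite !addr0 f0 addr0.
Qed.

Lemma ler_opnorm (f : clin) (x : V) : `|f x| <= opnorm f * `|x|.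
Proof.
have [->|x0] := eqVneq x 0.
  by rewrite -[X in f X](scale0r 0) clinZ scale0r !normr0 mulr0.
have nx0 : 0 < `|x| by rewrite normr_gt0.
rewrite -ler_pdivrMr// mulrC.
have := @ler_opnorm1 f (`|x|^-1 *: x).
rewrite clinZ !normrZ normfV normr_id; apply.
by rewrite mulVf ?gt_eqF.
Qed.

Fact opnormD (f g : clin) : opnorm (f + g) <= opnorm f + opnorm g.
Proof.
apply: opnorm_le => x x1; apply: (le_trans (ler_normD (f x) (g x))).
by apply: lerD; exact: ler_opnorm1.
Qed.

Fact opnormZ (k : R) (f : clin) : opnorm (k *: f) = `|k| * opnorm f.
Proof.
have le_Z (l : R) (g : clin) : opnorm (l *: g) <= `|l| * opnorm g.
  apply: opnorm_le => x x1; rewrite -[X in `|X|]/(l *: g x) normrZ.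
  by rewrite ler_wpM2l// ler_opnorm1.
apply/le_anti; rewrite le_Z /=.
have [->|k0] := eqVneq k 0; first by rewrite normr0 mul0r opnorm_ge0.
have nk0 : 0 < `|k| by rewrite normr_gt0.
rewrite -ler_pdivlMl// -normfV.
by apply: le_trans (le_Z _ _); rewrite scalerA mulVf// scale1r.
Qed.

Fact opnorm0_eq0 (f : clin) : opnorm f = 0 -> f = 0.
Proof.
move=> f0; apply: val_inj; apply/funext => x /=.
by apply/eqP; have := ler_opnorm f x; rewrite f0 mul0r normr_le0.
Qed.

HB.instance Definition _ :=
  Lmodule_isNormed.Build R clin opnormD opnormZ opnorm0_eq0.

End ContinuousLinearMaps.

Section Smooth.
Variables (R : realType) (V : normedModType R).

(* The Fréchet derivative of f as a map from V to the continuous linear maps;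
   at a point where f is not differentiable the value is irrelevant. *)
Definition frechet (W : normedModType R) (f : V -> W) (x : V) : clin V W :=
  insubd (0 : clin V W) ('d f x : V -> W).

Lemma frechetE (W : normedModType R) (f : V -> W) (x : V) :
  differentiable f x -> frechet f x = 'd f x :> (V -> W).
Proof.
move=> fx; rewrite /frechet -[LHS]/(val _) val_insubd ifT//.
by apply/asboolP; split; [exact: linearP|exact: diff_continuous].
Qed.

Fixpoint Ck_on (k : nat) (W : normedModType R) (U : set V) (f : V -> W) : Prop :=
  if k is k'.+1 then
    (forall x, U x -> differentiable f x) /\ Ck_on k' U (frechet f)
  else forall x, U x -> {for x, continuous f}.

Definition smooth_on (W : normedModType R) (U : set V) (f : V -> W) : Prop :=
  forall k, Ck_on k U f.

End Smooth.

Definition diffeomorphism (R : realType) (V W : normedModType R)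
    (X : set V) (Y : set W) (f : V -> W) (g : W -> V) : Prop :=
  [/\ open X /\ open Y,
      set_fun X Y f /\ set_fun Y X g,
      {in X, cancel f g} /\ {in Y, cancel g f},
      smooth_on X f
    & smooth_on Y g].

(* MathComp-Analysis's normed structures cannot be joined with unitRingType, so
   the norm is a real-valued operation of the algebra, and the Banach space is
   the alias [realification] below. *)
HB.mixin Record UnitAlgebra_isNormedAlgebra (R : realType) A
    of GRing.UnitAlgebra R[i] A := {
  anorm : A -> R ;
  anormD : forall x y : A, anorm (x + y) <= anorm x + anorm y ;
  anormZ : forall (c : R[i]) (x : A),
    (anorm (c *: x))%:C = `|c| * (anorm x)%:C ;
  anorm0_eq0 : forall x : A, anorm x = 0 -> x = 0 ;
  anormM : forall x y : A, anorm (x * y) <= anorm x * anorm y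
}.

#[short(type="normedAlgType")]
HB.structure Definition NormedAlgebra (R : realType) :=
  {A of GRing.UnitAlgebra R[i] A & UnitAlgebra_isNormedAlgebra R A}.

(* The real normed space underlying a complex normed algebra. *)
Definition realification (R : realType) (A : normedAlgType R) : Type := A.

Section Realification.
Variables (R : realType) (A : normedAlgType R).
Local Notation AR := (realification A).

HB.instance Definition _ := GRing.Zmodule.on AR.

Definition rscale (r : R) (x : AR) : AR := r%:C *: (x : A).

Fact rscaleA (a b : R) (x : AR) : rscale a (rscale b x) = rscale (a * b) x.
Proof. by rewrite /rscale scalerA rmorphM. Qed.

Fact rscale1 : left_id 1 rscale.
Proof. by move=> x; rewrite /rscale scale1r. Qed.

Fact rscaleDr : right_distributive rscale +%R.
Proof. by move=> a x y; rewrite /rscale -scalerDr. Qed.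

Fact rscaleDl (x : AR) : {morph rscale^~ x : a b / a + b}.
Proof. by move=> a b; rewrite /rscale rmorphD -scalerDl. Qed.

HB.instance Definition _ := GRing.Zmodule_isLmodule.Build R AR
  rscaleA rscale1 rscaleDr rscaleDl.

Fact rnormZ (r : R) (x : AR) :
  anorm (r *: x : A) = `|r| * anorm (x : A).
Proof.
apply: (@complexI R); rewrite -[X in anorm X]/(r%:C *: (x : A)).
by rewrite anormZ rmorphM normc_def/= expr0n addr0 sqrtr_sqr.
Qed.

HB.instance Definition _ := Lmodule_isNormed.Build R AR
  (@anormD R A) rnormZ (@anorm0_eq0 R A).

End Realification.

HB.mixin Record NormedAlgebra_isCStarAlgebra (R : realType) A
    of NormedAlgebra R A := {
  star : A -> A ;
  starK : involutive star ;
  starD : forall x y : A, star (x + y) = star x + star y ;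
  starZ : forall (c : R[i]) (x : A), star (c *: x) = c^* *: star x ;
  starM : forall x y : A, star (x * y) = star y * star x ;
  cstar_norm : forall x : A, anorm (star x * x) = anorm x ^+ 2 ;
  banach : forall F : set_system (realification A),
    ProperFilter F -> cauchy F -> cvg F
}.

#[short(type="cStarAlgType")]
HB.structure Definition CStarAlgebra (R : realType) :=
  {A of NormedAlgebra R A & NormedAlgebra_isCStarAlgebra R A}.

HB.instance Definition _ (R : realType) (A : cStarAlgType R) :=
  Uniform_isComplete.Build (realification A) (@banach R A).

Section CayleyTransform.
Variables (R : realType) (A : cStarAlgType R).
Implicit Types (a h z : A).

Definition spectrum a : set R[i] :=
  [set c | ~~ (a - c%:A \is a GRing.unit)].

(* In R[i], [0 <= c] means that c is real and nonnegative. *)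
Definition positive a : Prop :=
  star a = a /\ forall c, spectrum a c -> 0 <= c.

Definition ImA h : A := (2%:R * 'i)^-1 *: (h - star h).

Definition halfspace : set A :=
  [set h | positive (ImA h) /\ ImA h \is a GRing.unit].

Definition disc : set A := [set z | anorm z < 1].

Definition Gamma h : A := (1 + 'i *: h) / (1 - 'i *: h).

Definition Gamma_inv z : A := 'i *: ((1 - z) / (1 + z)).

End CayleyTransform.

(* Main.v *)
From HB Require Import structures.
Require Import Defs.
From mathcomp Require Import all_boot all_order all_algebra complex.
From mathcomp Require Import all_classical all_reals all_analysis.
From mathcomp Require Import ring lra.

(** Call [x] accretive if [|m - x| < m] for some real [m].  Accretive elements
    form a cone, are invertible by the Neumann series, and [x] is accretive as
    soon as [x + x^*] is.  A self-adjoint element is accretive iff it is positive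
    and invertible; the only spectral input is that a self-adjoint [e] of norm 1
    has [1 - e^2] singular, which has an elementary proof.  Hence [h] is in the
    half space iff [x = - i h] is accretive, and the Cayley transform becomes
    [z = (1 - x) / (1 + x)].  If [s = |z^* z|] were at least 1, then both
    [s - z^* z] and [s + z^* z] would be congruent to positive combinations of the
    accretive elements [1 + x^* x] and [x + x^*], hence invertible, contradicting
    the spectral radius statement for [z^* z].  Conversely the imaginary part of
    the inverse transform of [z] is congruent to [1 - z^* z].

    Both maps are affine in [f x = (1 + c x)^-1], whose derivative is bilinear in
    [(f, f)]; since bounded bilinear maps preserve [C^k], [f] is smooth. *)

Set Implicit Arguments.
Unset Strict Implicit.
Unset Printing Implicit Defensive.

Import Order.TTheory GRing.Theory Num.Theory.
Import numFieldNormedType.Exports.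

Local Open Scope classical_set_scope.
Local Open Scope ring_scope.
Local Open Scope complex_scope.

(** * Norm rules of the algebra, transported from its underlying real normed space *)

Section NormedAlgebraTheory.
Variables (R : realType) (A : normedAlgType R).
Implicit Types (x y k : A) (r : R).
Local Notation AR := (realification A).

Lemma anorm0 : anorm (0 : A) = 0.
Proof. exact: (@normr0 _ AR). Qed.

Lemma anorm_ge0 x : 0 <= anorm x.
Proof. exact: (@normr_ge0 _ AR). Qed.

Lemma anormN x : anorm (- x) = anorm x.
Proof. exact: (@normrN _ AR). Qed.

Lemma anormB x y : anorm (x - y) <= anorm x + anorm y.
Proof. exact: (@ler_normB _ AR). Qed.

Lemma anorm_eq0 x : (anorm x == 0) = (x == 0).
Proof. exact: (@normr_eq0 _ AR). Qed.

Lemma anorm_gt0 x : (0 < anorm x) = (x != 0).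
Proof. exact: (@normr_gt0 _ AR). Qed.

Lemma anormZr r x : anorm (r%:C *: x) = `|r| * anorm x.
Proof. exact: (@normrZ _ AR). Qed.

Lemma anormMn x n : anorm (x *+ n) = anorm x *+ n.
Proof. exact: (@normrMn _ AR). Qed.

Lemma anorm_sum (I : Type) (s : seq I) (P : pred I) (F : I -> A) :
  anorm (\sum_(i <- s | P i) F i) <= \sum_(i <- s | P i) anorm (F i).
Proof. exact: (@ler_norm_sum _ AR). Qed.

Lemma anormi x : anorm ('i *: x) = anorm x.
Proof.
by apply: (@complexI R); rewrite anormZ normCi mul1r.
Qed.


End NormedAlgebraTheory.

(** Banach's fixed point theorem on the whole space; it is the sole use of completeness and replaces
    the summation of the Neumann series. *)
Lemma lipschitz_fixpoint (R : realType) (V : completeNormedModType R)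
    (f : V -> V) (q : R) : 0 <= q < 1 ->
  (forall x y, `|f x - f y| <= q * `|x - y|) -> exists x, x = f x.
Proof.
move=> /andP[q0 q1] fq.
have fT : set_fun setT setT f by [].
pose g : {fun setT >-> setT} := HB.pack f (isFun.Build _ _ setT setT f fT).
have gc : is_contraction g by exists (NngNum q0); split=> // -[x y] _ /=; exact: fq.
by have [||x _ xE] := banach_fixed_point gc; [exact: closedT|exists 0|exists x].
Qed.

(** The discs [|m - c| < m] exhaust the open right half plane, so this norm condition stands in for
    positivity and invertibility of the real part without mentioning a spectrum. It forces
    [m > 0]. *)
Definition accretive (R : realType) (A : normedAlgType R) (x : A) :=
  exists m : R, anorm (m%:C%:A - x) < m.

(** * Involution, C*-norm and invertibility far from the spectrum *)

Section CStarTheory.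
Variables (R : realType) (A : cStarAlgType R).
Implicit Types (a b e k x y z : A) (r s t m : R) (c : R[i]).
Local Notation AR := (realification A).

Lemma star0 : star (0 : A) = 0.
Proof. by rewrite -[in LHS](scale0r 0) starZ conjC0 scale0r. Qed.

Lemma starN x : star (- x) = - star x.
Proof. by apply/eqP; rewrite -addr_eq0 -starD addNr star0. Qed.

Lemma starB x y : star (x - y) = star x - star y.
Proof. by rewrite starD starN. Qed.

Lemma star1 : star (1 : A) = 1.
Proof. by rewrite -[LHS]mulr1 -{2}[1]starK -starM mulr1 starK. Qed.

Lemma starZr r x : star (r%:C *: x) = r%:C *: star x.
Proof. by rewrite starZ; congr (_ *: _); exact: conjc_real. Qed.

Lemma stari x : star ('i *: x) = - ('i *: star x).
Proof. by rewrite starZ conjCi scaleNr. Qed.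

Lemma star_unit x : (star x \is a GRing.unit) = (x \is a GRing.unit).
Proof.
suff H y : y \is a GRing.unit -> star y \is a GRing.unit.
  by apply/idP/idP => [/H|/H //]; rewrite starK.
move=> yu; apply/unitrP; exists (star y^-1).
by rewrite -!starM divrr // mulVr // star1.
Qed.

Lemma starV x : x \is a GRing.unit -> star x^-1 = (star x)^-1.
Proof.
move=> xu; apply: (mulrI (_ : star x \is a GRing.unit)); first by rewrite star_unit.
by rewrite -starM mulVr // star1 divrr // star_unit.
Qed.

(** The C*-identity and submultiplicativity give [|y|^2 <= |star y| |y|]; cancel [|y|] and exchange
    [y] with [star y]. *)
Lemma anorm_star x : anorm (star x) = anorm x.
Proof.
suff H y : anorm y <= anorm (star y).
  by apply/le_anti; rewrite H andbT -{2}[x]starK H.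
have [->|y0] := eqVneq y 0; first by rewrite anorm0 anorm_ge0.
have yp : 0 < anorm y by rewrite anorm_gt0.
by rewrite -(ler_pM2r yp) -expr2 -cstar_norm anormM.
Qed.

Lemma anorm1 : anorm (1 : A) = 1.
Proof.
have n0 : anorm (1 : A) != 0 by rewrite anorm_eq0 oner_eq0.
by apply: (mulfI n0); rewrite mulr1 -expr2 -cstar_norm star1 mulr1.
Qed.

Lemma anormA r : anorm (r%:C%:A : A) = `|r|.
Proof. by rewrite anormZr anorm1 mulr1. Qed.

Lemma anorm_sqr a : star a = a -> anorm (a * a) = anorm a ^+ 2.
Proof. by move=> sa; rewrite -cstar_norm sa. Qed.

Lemma starX x n : star (x ^+ n) = star x ^+ n.
Proof. by elim: n => [|n IH]; rewrite ?star1 // exprS exprSr starM IH. Qed.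

Lemma anormX_pow2 a n : star a = a -> anorm (a ^+ (2 ^ n)) = anorm a ^+ (2 ^ n).
Proof.
move=> sa; elim: n => [|n IH]; first by rewrite !expr1.
rewrite expnSr !exprM expr2 anorm_sqr ?IH //.
by rewrite starX sa.
Qed.

Lemma anormX_le x n : anorm (x ^+ n) <= anorm x ^+ n.
Proof.
elim: n => [|n IH]; first by rewrite anorm1.
by rewrite !exprS (le_trans (anormM _ _)) // ler_wpM2l // anorm_ge0.
Qed.

(** A right and a left inverse arise as fixed points of the contractions [x |-> 1 + k x] and
    [x |-> 1 + x k]; associativity identifies them. *)
Lemma neumann k : anorm k < 1 -> 1 - k \is a GRing.unit.
Proof.
move=> k1; have k01 : 0 <= anorm k < 1 by rewrite anorm_ge0.
have [x xE] : exists x : AR, x = 1 + k * (x : A).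
  apply: (@lipschitz_fixpoint R AR (fun x => 1 + k * (x : A)) _ k01) => x y.
  rewrite opprD addrACA subrr add0r -mulrBr.
  exact: (anormM k ((x : A) - y)).
have [y yE] : exists y : AR, y = 1 + (y : A) * k.
  apply: (@lipschitz_fixpoint R AR (fun x => 1 + (x : A) * k) _ k01) => y z.
  rewrite opprD addrACA subrr add0r -mulrBl mulrC.
  exact: (anormM ((y : A) - z) k).
have xr : (1 - k) * (x : A) = 1 by rewrite mulrBl mul1r {1}xE addrK.
have yl : (y : A) * (1 - k) = 1 by rewrite mulrBr mulr1 {1}yE addrK.
have xy : (x : A) = y by rewrite -[LHS]mul1r -yl -mulrA xr mulr1.
by apply/unitrP; exists (x : A); split => //; rewrite xy.
Qed.

(** Factor [x - c] as [- c (1 - c^-1 x)]. The bound [|x| < |c|] is squared and written in real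
    coordinates, the form in which Arens' trick delivers it. *)
Lemma unit_subA x c : anorm x ^+ 2 < complex.Re c ^+ 2 + complex.Im c ^+ 2 ->
  x - c%:A \is a GRing.unit.
Proof.
move=> xc.
have c0 : c != 0.
  apply: contraTneq xc => ->; rewrite -leNgt /= expr0n addr0.
  exact: sqr_ge0.
have cu : c \is a GRing.unit by rewrite unitfE.
have -> : x - c%:A = - (c *: (1 - c^-1 *: x)).
  by rewrite scalerBr scalerA mulfV // scale1r opprB.
rewrite unitrN scaler_unit //; apply: neumann.
rewrite -ltcR anormZ normrV // mulrC ltr_pdivrMr ?normr_gt0 // mul1r.
rewrite normc_def ltcR -(ltr_pXn2r (n := 2)) ?nnegrE ?anorm_ge0 ?sqrtr_ge0 //.
by rewrite sqr_sqrtr // addr_ge0 // sqr_ge0.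
Qed.

Lemma unit_subAr x r : anorm x < `|r| -> x - r%:C%:A \is a GRing.unit.
Proof.
move=> xr; apply: unit_subA; rewrite /= expr0n addr0 -[ltRHS]real_normK ?num_real //.
by rewrite ltr_pXn2r // nnegrE anorm_ge0.
Qed.

(* Arens' trick: [|a + i m| ^ 2 <= |a| ^ 2 + m ^ 2] for real [m], whereas the
   distance from [c] to [- i m] grows faster for a suitable sign of [m]. *)
Lemma spectrum_real a c : star a = a -> complex.Im c != 0 -> a - c%:A \is a GRing.unit.
Proof.
case: c => u v sa /= v0.
(* This [m] solves [2 v m = |a|^2], so that [u^2 + (v + m)^2] exceeds [|a|^2 + m^2] by exactly
   [u^2 + v^2 > 0]. *)
pose m : R := anorm a ^+ 2 / (2 * v).
have -> : a - (u +i* v)%C%:A = (a + (0 +i* m)%C%:A) - (u +i* (v + m))%C%:A.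
  rewrite -addrA; congr (_ + _); rewrite -scalerBl -scaleNr; congr (_ *: _).
  by apply/eqP; rewrite eq_complex /= sub0r eqxx /=; apply/eqP; lra.
apply: unit_subA => /=.
have sm : star (a + (0 +i* m)%C%:A) = a - (0 +i* m)%C%:A.
  rewrite starD starZ star1 sa; congr (_ + _); rewrite -scaleNr; congr (_ *: _).
  by apply/eqP; rewrite eq_complex /= oppr0 !eqxx.
have -> : anorm (a + (0 +i* m)%C%:A) ^+ 2 = anorm (a * a + (m ^+ 2)%:C%:A).
  rewrite -cstar_norm sm; congr anorm.
  set M := _%:A; have Ma : M * a = a * M by rewrite -scalerAl -scalerAr mul1r mulr1.
  rewrite mulrBl !mulrDr Ma addrKA -[M * M]scalerAl mul1r scalerA -scaleNr.
  by congr (_ + _ *: _); apply/eqP; rewrite eq_complex /=; apply/andP; split; apply/eqP; ring.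
apply: (le_lt_trans (anormD _ _)); rewrite anormA anorm_sqr // ger0_norm ?sqr_ge0 //.
have mE : 2 * v * m = anorm a ^+ 2 by rewrite /m mulrC divfK // mulf_neq0.
have vp : 0 < v ^+ 2 by rewrite exprn_even_gt0.
rewrite -subr_gt0.
have -> : u ^+ 2 + (v + m) ^+ 2 - (anorm a ^+ 2 + m ^+ 2) =
    u ^+ 2 + v ^+ 2 + (2 * v * m - anorm a ^+ 2) by ring.
by rewrite mE subrr addr0 ltr_wpDl // sqr_ge0.
Qed.

End CStarTheory.

(** * A self-adjoint element attains its norm on the spectrum, up to sign *)

Section SpectralRadius.
Variables (R : realType) (A : cStarAlgType R).
Implicit Types (a b e k x y z : A) (r s t m : R) (c : R[i]).
Local Notation AR := (realification A).

(* Expanding [(1 + e) ^+ M] shows that [|1 + e| = 2] would force every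
   [\sum_(i <= M) e ^+ i] with [M] a power of 2 to have the maximal norm [M.+1],
   whereas multiplying this sum by [1 - e] gives [1 - e ^+ M.+1]. *)
Lemma anorm_add1_lt2 e : star e = e -> anorm e <= 1 -> 1 - e \is a GRing.unit ->
  anorm (1 + e) < 2.
Proof.
move=> se e1 eu; rewrite ltNge; apply/negP => le2.
have sD : star (1 + e) = 1 + e by rewrite starD star1 se.
have eX n : anorm (e ^+ n) <= 1.
  by apply: (le_trans (anormX_le _ _)); rewrite exprn_ile1 // anorm_ge0.
have large n : (2 ^ n).+1%:R <= anorm (\sum_(i < (2 ^ n).+1) e ^+ i).
  set M := (2 ^ n)%N.
  have E : (1 + e) ^+ M =
      \sum_(i < M.+1) e ^+ i + \sum_(i < M.+1) e ^+ i *+ 'C(M, i).-1.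
    rewrite addrC exprD1n -big_split; apply: eq_bigr => i _ /=.
    have : (0 < 'C(M, i))%N by rewrite bin_gt0 -ltnS.
    by case: 'C(M, i) => // q _; rewrite mulrS.
  have C : (2 ^ M)%N = (M.+1 + \sum_(i < M.+1) 'C(M, i).-1)%N.
    have -> : (2 ^ M)%N = (\sum_(i < M.+1) 'C(M, i))%N.
      have := Pascal 1 1 M; rewrite addn1 => ->.
      by apply: eq_bigr => i _; rewrite !exp1n !muln1.
    have M1 : (\sum_(i < M.+1) 1)%N = M.+1 by rewrite sum1_card card_ord.
    rewrite -[X in (X + _)%N]M1 -big_split /=; apply: eq_bigr => i _.
    by rewrite add1n prednK // bin_gt0 -ltnS.
  (* Repeated squaring turns the C*-identity into [|(1 + e) ^+ M| = |1 + e| ^+ M], which is why [M]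
     is a power of 2. *)
  have : 2 ^+ M <= anorm ((1 + e) ^+ M) by rewrite anormX_pow2 // lerXn2r // nnegrE ?anorm_ge0.
  rewrite -natrX C natrD E => /le_trans/(_ (anormD _ _)) H.
  rewrite -(lerD2r (\sum_(i < M.+1) 'C(M, i).-1)%N%:R); apply: (le_trans H).
  rewrite lerD2l (le_trans (anorm_sum _ _ _)) // natr_sum ler_sum // => i _.
  by rewrite anormMn lerMn2r eX orbT.
have bounded n : anorm (\sum_(i < n) e ^+ i) <= 2 * anorm (1 - e)^-1.
  rewrite -[\sum_(i < n) _](mulKr eu) mulrC.
  apply: (le_trans (anormM _ _)); rewrite ler_wpM2l ?anorm_ge0 //.
  have -> : (1 - e) * (\sum_(i < n) e ^+ i) = 1 - e ^+ n.
    by rewrite -opprB mulNr -subrX1 opprB.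
  by apply: (le_trans (anormB _ _)); have := eX n; rewrite anorm1; lra.
pose N := Num.bound (2 * anorm (1 - e)^-1).
have : N%:R <= 2 * anorm (1 - e)^-1.
  apply: le_trans (bounded (2 ^ N).+1); apply: le_trans (large N).
  by rewrite ler_nat leqW // ltnW // ltn_expl.
by rewrite leNgt archi_boundP // mulr_ge0 // anorm_ge0.
Qed.

(* With [y = i e] one has [4 y = (1 + y) ^ 2 - (1 - y) ^ 2], so [|1 + e ^ 2|], which
   is [|1 + y| ^ 2], is at least 2; apply the previous lemma to [e ^ 2]. *)
Lemma spectral_radius1 e : star e = e -> anorm e = 1 -> ~ (1 - e * e \is a GRing.unit).
Proof.
move=> se e1 eu.
have se2 : star (e * e) = e * e by rewrite starM se.
have e21 : anorm (e * e) = 1 by rewrite anorm_sqr // e1 expr1n.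
suff : 2 <= anorm (1 + e * e).
  by rewrite leNgt anorm_add1_lt2 // e21.
pose y := 'i *: e.
have yy : y * y = - (e * e).
  by rewrite -scalerAl -scalerAr scalerA -expr2 sqrCi scaleN1r.
have sy : star y = - y by rewrite stari se.
have pq : (1 + y) * (1 - y) = 1 + e * e.
  by rewrite mulrDl mul1r mulrBr mulr1 yy opprK addrA subrK.
have qp : (1 - y) * (1 + y) = 1 + e * e.
  by rewrite mulrBl mul1r mulrDr mulr1 yy opprD opprK addrA addrK.
have p2 : anorm (1 + y) ^+ 2 = anorm (1 + e * e).
  by rewrite -cstar_norm starD star1 sy qp.
have q2 : anorm (1 - y) ^+ 2 = anorm (1 + e * e).
  by rewrite -cstar_norm starB star1 sy opprK pq.
have yE : y *+ 4 = (1 + y) * (1 + y) - (1 - y) * (1 - y).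
  rewrite -!expr2 ![1 + _]addrC !sqrrD1 sqrrN mulNrn opprD addrACA subrr addr0.
  by rewrite opprD addrACA subrr add0r opprK -mulrnDr.
have : anorm (y *+ 4) <= anorm (1 + e * e) *+ 2.
  rewrite yE (le_trans (anormB _ _)) // mulr2n lerD //.
    by rewrite -p2 expr2 anormM.
  by rewrite -q2 expr2 anormM.
rewrite anormMn anormi e1.
lra.
Qed.
End SpectralRadius.

(** * The cone of accretive elements *)

Section Accretive.
Variables (R : realType) (A : cStarAlgType R).
Implicit Types (a b e k x y z : A) (r s t m : R) (c : R[i]).
Local Notation AR := (realification A).

Lemma unit_real r : (r%:C \is a @GRing.unit R[i]) = (r != 0).
Proof. by rewrite unitfE -(inj_eq (@complexI R)). Qed.

(** For [e = b / |b|], the element [1 - e^2] is [- (e - 1) (e + 1)], a product of two units, against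
    [spectral_radius1]. *)
Lemma spectral_radius b : star b = b -> b != 0 ->
  b - (anorm b)%:C%:A \is a GRing.unit -> b + (anorm b)%:C%:A \is a GRing.unit -> False.
Proof.
move=> sb b0; set s := anorm b => u1 u2.
have s0 : 0 < s by rewrite /s anorm_gt0.
have su : s%:C \is a @GRing.unit R[i] by rewrite unit_real gt_eqF.
pose e := (s^-1)%:C *: b.
have se : star e = e by rewrite starZr sb.
have ne : anorm e = 1 by rewrite anormZr gtr0_norm ?invr_gt0 // mulVf // gt_eqF.
have bE : b = s%:C *: e by rewrite scalerA -rmorphM mulfV ?gt_eqF // scale1r.
apply: (spectral_radius1 se ne).
have -> : 1 - e * e = - ((e - 1) * (e + 1)).
  by rewrite mulrDr mulr1 mulrBl mul1r addrA subrK opprB.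
have ue : e - 1 \is a GRing.unit by rewrite -(scaler_unit _ su) scalerBr -bE.
by rewrite unitrN unitrMr // -(scaler_unit _ su) scalerDr -bE.
Qed.

(** Moving the centre from [m] to a larger [m'] adds at most [m' - m] to the distance, so the gap
    [d] between radius and distance persists. *)
Lemma accretive_large x : accretive x ->
  exists m0 d, 0 < d /\ forall m, m0 <= m -> anorm (m%:C%:A - x) <= m - d.
Proof.
move=> [m xm]; exists m, (m - anorm (m%:C%:A - x)); rewrite subr_gt0; split=> // m' mm'.
have -> : m'%:C%:A - x = (m' - m)%:C%:A + (m%:C%:A - x).
  by rewrite addrA -scalerDl -rmorphD subrK.
apply: (le_trans (anormD _ _)); rewrite anormA ger0_norm ?subr_ge0 //.
lra.
Qed.

Lemma accretive_unit x : accretive x -> x \is a GRing.unit.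
Proof.
move=> [m xm]; have -> : x = - ((m%:C%:A - x) - m%:C%:A) by rewrite addrAC subrr sub0r opprK.
by rewrite unitrN unit_subAr // ger0_norm // (le_trans _ (ltW xm)) // anorm_ge0.
Qed.

Lemma accretiveD x y : accretive x -> accretive y -> accretive (x + y).
Proof.
move=> [m xm] [n yn]; exists (m + n).
have -> : (m + n)%:C%:A - (x + y) = (m%:C%:A - x) + (n%:C%:A - y).
  by rewrite rmorphD scalerDl opprD addrACA.
by apply: (le_lt_trans (anormD _ _)); exact: ltrD.
Qed.

Lemma accretiveZ r x : 0 < r -> accretive x -> accretive (r%:C *: x).
Proof.
move=> r0 [m xm]; exists (r * m).
rewrite rmorphM -scalerA -scalerBr anormZr gtr0_norm //.
by rewrite ltr_pM2l.
Qed.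

Lemma accretiveDZ r x y : 0 <= r -> accretive x -> accretive y -> accretive (x + r%:C *: y).
Proof.
rewrite le_eqVlt => /predU1P[<- ? _|r0 ? ?]; first by rewrite scale0r addr0.
by apply: accretiveD => //; exact: accretiveZ.
Qed.

Lemma accretive_near1 k : anorm k < 1 -> accretive (1 - k).
Proof. by move=> k1; exists 1; rewrite scale1r opprB addrC subrK. Qed.

Lemma accretive1 : accretive (1 : A).
Proof. by rewrite -[1](subr0) ; apply: accretive_near1; rewrite anorm0. Qed.

Lemma accretive_star x : accretive x -> accretive (star x).
Proof.
move=> [m xm]; exists m.
by rewrite -[X in X - _](_ : star (m%:C%:A) = _) -?starB ?anorm_star // starZr star1.
Qed.

(** Expanding, [|m - x|^2 = |m (m - (x + star x)) + star x * x| <= m (m - d) + |x|^2], which is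
    below [m^2] once [m d > |x|^2]. *)
Lemma accretive_Re x : accretive (x + star x) -> accretive x.
Proof.
move=> /accretive_large[m0 [d [d0 H]]].
pose m := Num.max m0 (anorm x ^+ 2 / d + 1).
have m_ge : m0 <= m by rewrite le_max lexx.
have m_gt : anorm x ^+ 2 / d < m.
  by rewrite lt_max; apply/orP; right; rewrite ltrDl.
have mp : 0 < m by apply: le_lt_trans m_gt; rewrite divr_ge0 ?sqr_ge0 // ltW.
exists m; rewrite -(ltr_pXn2r (n := 2)) ?nnegrE ?anorm_ge0 ?(ltW mp) //.
rewrite -cstar_norm starB starZr star1.
have -> : (m%:C%:A - star x) * (m%:C%:A - x) = m%:C *: (m%:C%:A - (x + star x)) + star x * x.
  rewrite mulrBl -scalerAl mul1r mulrBr -scalerAr mulr1.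
  by rewrite opprB addrCA addrC -scalerBr -addrA -opprD.
apply: (le_lt_trans (anormD _ _)); rewrite anormZr gtr0_norm // cstar_norm.
have := ler_wpM2l (ltW mp) (H _ m_ge); move: m_gt; rewrite ltr_pdivrMr // => m_gt ?.
have -> : m ^+ 2 = m * (m - d) + m * d by ring.
by apply: ler_ltD.
Qed.

(** The spectrum is real, and for [c < 0] one has [|m - a| < m < m - c], so [a - c] is
    invertible. *)
Lemma accretive_positive a : star a = a -> accretive a -> positive a /\ a \is a GRing.unit.
Proof.
move=> sa aa; split; last exact: accretive_unit.
split=> // c ca.
have /eqP c0 : complex.Im c == 0 by apply: contraNT ca => /(spectrum_real sa).
rewrite lecE c0 eqxx /=; apply: contraNT ca; rewrite -ltNge => c1.
have -> : c = (complex.Re c)%:C by case: (c) c0 => ? ? /= ->.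
case: aa => m am.
have -> : a - (complex.Re c)%:C%:A = - ((m%:C%:A - a) - (m - complex.Re c)%:C%:A).
  by rewrite rmorphB scalerBl !opprB [RHS]addrC addrA subrK.
rewrite unitrN unit_subAr // gtr0_norm; first by rewrite (lt_trans am) // ltrDl oppr_gt0.
have := anorm_ge0 (m%:C%:A - a); lra.
Qed.

(** By [spectral_radius], a distance [q = |T - a|] above [T - s] would make [a - (T - q)] or
    [a - (T + q)] singular. The first is invertible by positivity if [T < q] and by the Neumann
    series if [0 <= T - q < s], the second because [T + q > |a|]. Hence [|T - a| <= T - s], and
    passing from [a] to [b] costs less than [s]. This room for perturbation drives the continuation
    in [accretive_sqr1]. *)
Lemma positive_accretive a b : positive a -> a \is a GRing.unit -> star b = b ->
  anorm (b - a) * anorm a^-1 < 1 -> accretive b.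
Proof.
move=> [sa pa] au sb ab.
have a'0 : 0 < anorm a^-1.
  by rewrite anorm_gt0; apply: contraTneq au => a0; rewrite -unitrV a0 unitr0.
(* [s] is the radius within which perturbing [a] keeps it invertible; [T] is chosen so that
   [T > |a|] and [T - s > 0], the latter making [q] nonzero. *)
pose s := (anorm a^-1)^-1; pose T := anorm a + 1 + s.
have s0 : 0 < s by rewrite invr_gt0.
have a0 := anorm_ge0 a.
have key : anorm (T%:C%:A - a) <= T - s.
  rewrite leNgt; apply/negP; set q := anorm _ => Tq.
  have q0 : 0 < q by apply: lt_trans Tq; rewrite /T addrK; lra.
  have sT : star (T%:C%:A - a) = T%:C%:A - a by rewrite starB starZr star1 sa.
  apply: (spectral_radius sT); first by rewrite -anorm_gt0.
    have -> : T%:C%:A - a - q%:C%:A = - (a - (T - q)%:C%:A).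
      by rewrite opprB rmorphB scalerBl addrAC.
    rewrite unitrN; have [Tq0|Tq0] := ltP (T - q) 0.
      apply: contraTT isT => /pa; rewrite lecE /= eqxx /=.
      by rewrite leNgt Tq0.
    have -> : a - (T - q)%:C%:A = a * (1 - (T - q)%:C *: a^-1).
      by rewrite mulrBr mulr1 -scalerAr divrr.
    rewrite unitrMr //; apply: neumann; rewrite anormZr ger0_norm //.
    by rewrite -[X in _ * X]invrK ltr_pdivrMr // mul1r ltrBlDr addrC -ltrBlDr.
  have -> : T%:C%:A - a + q%:C%:A = - (a - (T + q)%:C%:A).
    by rewrite opprB (rmorphD _ T) scalerDl addrAC.
  have aT : anorm a < T by rewrite /T; lra.
  rewrite unitrN unit_subAr // gtr0_norm; first lra.
  by apply: addr_gt0 => //; apply: le_lt_trans aT.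
exists T; have -> : T%:C%:A - b = (T%:C%:A - a) - (b - a) by rewrite opprB addrA subrK.
apply: (le_lt_trans (anormB _ _)); move: ab; rewrite -ltr_pdivlMr // mul1r -/s; lra.
Qed.

Lemma positive_unit_accretive a : positive a -> a \is a GRing.unit -> accretive a.
Proof.
move=> pa au; apply: (positive_accretive pa au) => //; first by case: pa.
by rewrite subrr anorm0 mul0r ltr01.
Qed.
End Accretive.

(** * The Cayley transform between accretive elements and the unit disc *)

Section Cayley.
Variables (R : realType) (A : cStarAlgType R).
Implicit Types (a b e h k x y z : A) (r s t m : R) (c : R[i]).
Local Notation AR := (realification A).

(** The inverse satisfies [w = 1 + k w], whence [|w| <= 1 + r |w|]. *)
Lemma neumann_inv_le k r : anorm k <= r -> r < 1 -> anorm (1 - k)^-1 <= (1 - r)^-1.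
Proof.
move=> kr r1; have k1 := le_lt_trans kr r1.
set w := (1 - k)^-1.
have wE : w = 1 + k * w.
  by apply/eqP; rewrite -subr_eq -[X in X - _]mul1r -mulrBl divrr // neumann.
have : anorm w <= 1 + r * anorm w.
  rewrite {1}wE (le_trans (anormD _ _)) // anorm1 lerD2l (le_trans (anormM _ _)) //.
  by rewrite ler_wpM2r // anorm_ge0.
have r1' : 0 < 1 - r by rewrite subr_gt0.
move=> H; rewrite -[leRHS]mul1r ler_pdivlMr // mulrBr mulr1 mulrC; lra.
Qed.

Lemma star_sqr x : star (star x * x) = star x * x.
Proof. by rewrite starM starK. Qed.

(* Positivity is propagated along [star (1 - t k) * (1 - t k)], from [t = 0] to
   [t = 1], in [n] steps whose size is controlled by the uniform bound [K] on the
   inverses of [1 - t k]. *)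
Lemma accretive_sqr1 k : anorm k < 1 -> accretive (star (1 - k) * (1 - k)).
Proof.
move=> k1; set r := anorm k in k1; have r0 : 0 <= r := anorm_ge0 _.
pose K := (1 - r)^-1; have K0 : 0 < K by rewrite invr_gt0 subr_gt0.
(* One step moves [star (x j) * x j] by at most [4 / n] and its inverse has norm at most [K ^+ 2];
   [positive_accretive] asks that the product be below 1. *)
pose n := Num.bound (4 * K ^+ 2).
have nK : 4 * K ^+ 2 < n%:R by rewrite archi_boundP // mulr_ge0 // sqr_ge0.
have n0 : 0 < n%:R :> R by apply: le_lt_trans nK; rewrite mulr_ge0 // sqr_ge0.
pose x j : A := 1 - (j%:R / n%:R)%:C *: k.
have tk j : (j <= n)%N -> anorm ((j%:R / n%:R)%:C *: k) <= r.
  move=> jn; rewrite anormZr ger0_norm ?divr_ge0 ?ler0n //.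
  by rewrite ler_piMl // ler_pdivrMr // mul1r ler_nat.
have xu j : (j <= n)%N -> x j \is a GRing.unit.
  by move=> /tk jr; apply: neumann; exact: le_lt_trans jr k1.
have x2 j : (j <= n)%N -> anorm (x j) <= 2.
  move=> /tk jr; apply: (le_trans (anormB _ _)); rewrite anorm1; lra.
have xV j : (j <= n)%N -> anorm (x j)^-1 <= K.
  by move=> /tk jr; apply: neumann_inv_le.
have dx j : anorm (x j.+1 - x j) <= n%:R^-1.
  rewrite /x opprB addrC addrA subrK -scalerBl -rmorphB -mulrBl.
  rewrite -natr1 opprD addrA subrr sub0r mulN1r anormZr normrN ger0_norm ?invr_ge0 ?ler0n //.
  by rewrite ler_piMr ?invr_ge0 ?ler0n // ltW.
suff H j : (j <= n)%N -> accretive (star (x j) * x j).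
  have := H n (leqnn n); rewrite /x divff ?gt_eqF // scale1r; exact.
elim: j => [_|j IH jn].
  by rewrite /x mul0r scale0r subr0 star1 mulr1; exact: (accretive1 A).
have jn' := ltnW jn.
have [pc cu] := accretive_positive (star_sqr _) (IH jn').
apply: (positive_accretive pc cu (star_sqr _)).
have c1 : anorm (star (x j) * x j)^-1 <= K ^+ 2.
  rewrite invrM ?star_unit ?xu // (le_trans (anormM _ _)) // -starV ?xu //.
  by rewrite anorm_star expr2 ler_pM ?anorm_ge0 // xV.
have c2 : anorm (star (x j.+1) * x j.+1 - star (x j) * x j) <= 4 / n%:R.
  have -> : star (x j.+1) * x j.+1 - star (x j) * x j =
      star (x j.+1 - x j) * x j.+1 + star (x j) * (x j.+1 - x j).
    by move: (x j.+1) (x j) => u v; rewrite starB mulrBl mulrBr addrA subrK.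
  apply: (le_trans (anormD _ _)).
  have -> : 4 / n%:R = n%:R^-1 * 2 + 2 * n%:R^-1 :> R by lra.
  by apply: lerD; apply: (le_trans (anormM _ _)); rewrite ?anorm_star ler_pM ?anorm_ge0 ?x2.
apply: (le_lt_trans (ler_pM (anorm_ge0 _) (anorm_ge0 _) c2 c1)).
by rewrite mulrAC ltr_pdivrMr // mul1r.
Qed.

(** By homogeneity: [x = m (1 - k)] with [|k| = |m - x| / m < 1]. *)
Lemma accretive_sqr x : accretive x -> accretive (star x * x).
Proof.
move=> [m xm]; have m0 : 0 < m := le_lt_trans (anorm_ge0 _) xm.
pose k := 1 - m^-1%:C *: x.
have xE : x = m%:C *: (1 - k).
  by rewrite /k opprB addrC subrK scalerA -rmorphM mulfV ?gt_eqF // scale1r.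
rewrite xE starZr -scalerAl -scalerAr scalerA -rmorphM.
apply: accretiveZ; first by rewrite mulr_gt0.
apply: accretive_sqr1.
have -> : k = m^-1%:C *: (m%:C%:A - x).
  by rewrite scalerBr scalerA -rmorphM mulVf ?gt_eqF // scale1r.
by rewrite anormZr gtr0_norm ?invr_gt0 // mulrC ltr_pdivrMr // mul1r.
Qed.

Lemma accretive_cayley x : accretive x -> anorm ((1 - x) / (1 + x)) < 1.
Proof.
move=> ax; set y := (1 + x)^-1; set z := _ * y.
have xu : 1 + x \is a GRing.unit by apply: accretive_unit; exact: accretiveD (accretive1 _) ax.
rewrite ltNge; apply/negP => z1.
set s := anorm (star z * z).
have s1 : 1 <= s by rewrite /s cstar_norm -[1](expr1n _ 2) lerXn2r // nnegrE ?anorm_ge0.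
(* Since [1 = star y * (P + Q) * y] and [star z * z = star y * (P - Q) * y], the elements
   [s - star z * z] and [s + star z * z] are congruent to [(s - 1) P + (s + 1) Q] and
   [(s + 1) P + (s - 1) Q]. *)
pose P := 1 + star x * x; pose Q := x + star x.
have aP : accretive P by apply: accretiveD (accretive1 _) _; exact: accretive_sqr.
have aQ : accretive Q by apply: accretiveD => //; exact: accretive_star.
have yE : star y = (star (1 + x))^-1 by rewrite starV.
have sxu : star (1 + x) \is a GRing.unit by rewrite star_unit.
have plusE : star (1 + x) * (1 + x) = P + Q.
  by rewrite starD star1 mulrDl mul1r mulrDr mulr1 [RHS]addrACA [star x * x + _]addrC.
have minusE : star (1 - x) * (1 - x) = P - Q.
  rewrite starB star1 mulrBl mul1r mulrBr mulr1 opprB.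
  by rewrite opprD [RHS]addrACA.
have oneE : star y * (P + Q) * y = 1.
  by rewrite -plusE mulrA yE mulVr // mul1r divrr.
have zE : star z * z = star y * (P - Q) * y by rewrite -minusE starM !mulrA.
clearbody P Q.
apply: (@spectral_radius R A (star z * z)); first exact: star_sqr.
- by rewrite -anorm_gt0 (lt_le_trans ltr01).
- rewrite -/s; have -> : star z * z - s%:C%:A =
    - (star y * ((s + 1)%:C *: Q + (s - 1)%:C *: P) * y).
    rewrite zE -oneE scalerAl scalerAr -mulrBl -mulrBr -mulNr -mulrN; congr (_ * _ * _).
    rewrite scalerDr [in LHS]opprD [LHS]addrACA [in RHS]opprD [RHS]addrC; congr (_ + _).
      by rewrite rmorphB scalerBl scale1r opprB.
    by rewrite rmorphD scalerDl scale1r opprD addrC.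
  rewrite unitrN unitrMr ?unitrV // unitrMl ?yE ?unitrV //.
  apply: accretive_unit; apply: accretiveDZ => //; first by rewrite subr_ge0.
  by apply: accretiveZ => //; rewrite ltr_wpDl // (le_trans _ s1).
rewrite -/s; have -> : star z * z + s%:C%:A = star y * ((s + 1)%:C *: P + (s - 1)%:C *: Q) * y.
  rewrite zE -oneE scalerAl scalerAr -mulrDl -mulrDr; congr (_ * _ * _).
  rewrite scalerDr addrACA; congr (_ + _).
    by rewrite rmorphD scalerDl scale1r addrC.
  by rewrite rmorphB scalerBl scale1r addrC.
rewrite unitrMr ?unitrV // unitrMl ?yE ?unitrV //.
apply: accretive_unit; apply: accretiveDZ => //; first by rewrite subr_ge0.
by apply: accretiveZ => //; rewrite ltr_wpDl // (le_trans _ s1).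
Qed.

Lemma ImA_star h : star (ImA h) = ImA h.
Proof.
rewrite /ImA starZ starB starK fmorphV rmorphM /= conjC_nat conjCi mulrN invrN.
by rewrite scaleNr -scalerN opprB.
Qed.

Lemma scale2 x : 2%:C *: x = x + x.
Proof. by rewrite rmorph_nat scaler_nat mulr2n. Qed.

(** For [x = - 'i *: h], the sum [x + star x] is [2 ImA h]. *)
Lemma halfspaceE h : halfspace h <-> accretive (- ('i *: h)).
Proof.
have E : - ('i *: h) + star (- ('i *: h)) = 2%:C *: ImA h.
  rewrite starN stari opprK /ImA scalerA invfM rmorph_nat mulrA mulfV ?pnatr_eq0 //.
  by rewrite mul1r invCi scaleNr scalerBr opprB addrC.
split=> [[ph hu]|ah].
  apply: accretive_Re; rewrite E; apply: accretiveZ; first by [].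
  exact: positive_unit_accretive.
have : accretive (2%:C *: ImA h) by rewrite -E; apply: accretiveD => //; exact: accretive_star.
move=> /(accretiveZ (r := 2^-1)); rewrite scalerA -rmorphM mulVf // scale1r => aI.
by apply: accretive_positive; [exact: ImA_star|apply: aI; rewrite invr_gt0].
Qed.

Lemma disc_unit z : disc z -> 1 + z \is a GRing.unit.
Proof. by rewrite /disc /= => z1; rewrite -[z]opprK; apply: neumann; rewrite anormN. Qed.

Lemma halfspace_unit h : halfspace h -> 1 - 'i *: h \is a GRing.unit.
Proof.
by move=> /halfspaceE ah; apply: accretive_unit; exact: accretiveD (accretive1 _) ah.
Qed.

Lemma Gamma_disc h : halfspace h -> disc (Gamma h).
Proof.
by move=> /halfspaceE/accretive_cayley; rewrite opprK.
Qed.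

(** With [v = 1 + z] and [q = 1 - star z * z], the imaginary part is [star v^-1 * q * v^-1].
    Subtracting [r < 0] from it replaces [q] by [q - r (star v * v)], still accretive because [v]
    is. *)
Lemma Gamma_inv_halfspace z : disc z -> halfspace (Gamma_inv z).
Proof.
move=> z1; have vu := disc_unit z1; set v := 1 + z in vu.
have av : accretive v by rewrite /v -[z]opprK; apply: accretive_near1; rewrite anormN.
pose q := 1 - star z * z.
have aq : accretive q.
  apply: accretive_near1; rewrite cstar_norm expr_lt1 // anorm_ge0 //.
have IE : ImA (Gamma_inv z) = star v^-1 * q * v^-1.
  have wE x : star v^-1 * (star v * x) = x.
    by rewrite mulrA -starM divrr // star1 mul1r.
  have vE : star v * (1 - z) + (1 - star z) * v = 2%:C *: q.
    rewrite /v starD star1 mulrDl mul1r mulrBr mulr1 mulrBl mul1r mulrDr mulr1.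
    rewrite addrACA [1 - z + _]addrACA addNr addr0.
    by rewrite opprD [star z - _ + _]addrACA subrr add0r scale2 addrACA.
  have hE : Gamma_inv z - star (Gamma_inv z) = 'i *: (star v^-1 * (2%:C *: q) * v^-1).
    rewrite /Gamma_inv -/v stari opprK -scalerDr starM starB star1 -vE; congr (_ *: _).
    by rewrite (mulrDr _ (star v * _)) (mulrDl (star v^-1 * _)) wE mulrA mulrK.
  rewrite /ImA hE -scalerAr -scalerAl !scalerA rmorph_nat -mulrA [X in _ * X]mulrC.
  by rewrite mulVf ?scale1r // mulf_neq0 ?pnatr_eq0 // neq0Ci.
have svu : star v^-1 \is a GRing.unit by rewrite star_unit unitrV.
have cu : ImA (Gamma_inv z) \is a GRing.unit.
  by rewrite IE unitrMr ?unitrV // unitrMl //; exact: accretive_unit.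
split=> //; split; first exact: ImA_star.
move=> c ca.
have /eqP c0 : complex.Im c == 0 by apply: contraNT ca => /(spectrum_real (ImA_star _)).
rewrite lecE c0 eqxx /=; apply: contraNT ca; rewrite -ltNge => c1.
have -> : c = (complex.Re c)%:C by case: (c) c0 => ? ? /= ->.
set r := complex.Re c in c1 *.
have -> : ImA (Gamma_inv z) - r%:C%:A = star v^-1 * (q + (- r)%:C *: (star v * v)) * v^-1.
  rewrite IE (mulrDr _ q) (mulrDl (_ * q)); congr (_ + _).
  rewrite -scalerAr -scalerAl rmorphN scaleNr; congr (- (_ *: _)).
  by rewrite mulrA mulrK // -starM divrr // star1.
rewrite unitrMr ?unitrV // unitrMl //; apply: accretive_unit.
apply: accretiveDZ => //; first by rewrite oppr_ge0 ltW.
exact: accretive_sqr.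
Qed.

(** Write [1 + x = 2 - (1 - x)]. A single inverse remains, which serves both the cancellation
    identities and smoothness. *)
Lemma cayleyE x : 1 - x \is a GRing.unit -> (1 + x) / (1 - x) = 2%:C *: (1 - x)^-1 - 1.
Proof.
move=> u; apply: (mulIr u); rewrite divrK // mulrBl -scalerAl mulVr // mul1r scale2.
by rewrite opprB addrACA subrr addr0.
Qed.

Lemma GammaE h : 1 - 'i *: h \is a GRing.unit -> Gamma h = 2%:C *: (1 - 'i *: h)^-1 - 1.
Proof. exact: cayleyE. Qed.

Lemma Gamma_invE z : 1 + z \is a GRing.unit -> Gamma_inv z = 'i *: (2%:C *: (1 + z)^-1 - 1).
Proof. by have := @cayleyE (- z); rewrite opprK /Gamma_inv => H /H ->. Qed.

Lemma GammaK h : halfspace h -> Gamma_inv (Gamma h) = h.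
Proof.
move=> hh; have u := halfspace_unit hh; have zu := disc_unit (Gamma_disc hh).
rewrite Gamma_invE // GammaE // subrKC invrZ ?unitrV ?unit_real ?pnatr_eq0 // invrK.
rewrite scalerA mulrV ?unit_real ?pnatr_eq0 // scale1r addrAC subrr add0r.
by rewrite scalerN scalerA -expr2 sqrCi scaleN1r opprK.
Qed.

Lemma Gamma_invK z : disc z -> Gamma (Gamma_inv z) = z.
Proof.
move=> zz; have u := disc_unit zz; have hu := halfspace_unit (Gamma_inv_halfspace zz).
have E : 1 - 'i *: Gamma_inv z = 2%:C *: (1 + z)^-1.
  by rewrite Gamma_invE // scalerA -expr2 sqrCi scaleN1r opprK subrKC.
rewrite GammaE // E invrZ ?unitrV ?unit_real ?pnatr_eq0 // invrK.
by rewrite scalerA mulrV ?unit_real ?pnatr_eq0 // scale1r addrAC subrr add0r.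
Qed.

End Cayley.

(** * Fréchet derivatives by explicit estimates *)

Section Frechet.
Variables (R : realType) (V W : normedModType R).
Implicit Types (f g : V -> W) (L : clin V W) (x h : V).

Lemma bounded_is_clin f (C : R) : linear f -> (forall x, `|f x| <= C * `|x|) -> is_clin f.
Proof.
move=> lf fC; apply/asboolP; split; first by [].
pose l : {linear V -> W} := HB.pack f (GRing.isLinear.Build R V W _ f lf).
apply: (@bounded_linear_continuous R V W l); apply/linear_boundedP.
by near=> r => x; rewrite (le_trans (fC x)) // ler_wpM2r.
Unshelve. all: by end_near. Qed.

Lemma clin_norm_le L (C : R) : 0 <= C -> (forall x, `|L x| <= C * `|x|) -> `|L| <= C.
Proof.
by move=> C0 LC; apply: opnorm_le => x x1; rewrite (le_trans (LC x)) // ler_piMr.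
Qed.

(** A relational derivative: the candidate [L] is carried explicitly, so rules can be proved by
    estimates; [has_frechetP] returns to [frechet] through uniqueness of the differential. *)
Definition has_frechet f x L := forall e : R, 0 < e ->
  \forall h \near (0 : V), `|f (h + x) - f x - L h| <= e * `|h|.

Lemma has_frechetP f x L : has_frechet f x L <-> differentiable f x /\ frechet f x = L.
Proof.
pose l : {linear V -> W} := HB.pack (L : V -> W)
  (GRing.isLinear.Build R V W _ (L : V -> W) (@clin_linear _ _ _ L)).
split=> [fL|[df <-]].
  have lE : f \o shift x = cst (f x) + l +o_ 0 id.
    apply/eqaddoP => e e0; have := fL e e0; apply: filterS => h /=.
    by rewrite -[X in _ -> `|X| <= _]/(f (h + x) - (f x + L h)) opprD addrA.
  have lc : continuous l by exact: (@clin_continuous _ _ _ L).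
  have dE := diff_unique lc lE.
  have df : differentiable f x by apply/diff_locallyP; rewrite dE.
  by split=> //; apply: val_inj; exact: etrans (frechetE df) dE.
move=> e e0; have /eqaddoP/(_ e e0) := diff_locally df.
apply: filterS => h; rewrite frechetE //.
by rewrite -[X in `|X| <= _ -> _]/(f (h + x) - (f x + 'd f x h)) opprD addrA.
Qed.

Lemma has_frechet_lip f x L : has_frechet f x L ->
  \forall h \near (0 : V), `|f (h + x) - f x| <= (1 + `|L|) * `|h|.
Proof.
move=> /(_ 1 ltr01); apply: filterS => h fh.
rewrite -[X in `|X|](subrK (L h)) (le_trans (ler_normD _ _)) // mulrDl lerD //.
exact: ler_opnorm.
Qed.

Lemma has_frechetD f g x L1 L2 : has_frechet f x L1 -> has_frechet g x L2 ->
  has_frechet (fun y => f y + g y) x (L1 + L2).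
Proof.
move=> fx gx e e0; have e2 : 0 < e / 2 by rewrite divr_gt0.
near=> h.
have -> : f (h + x) + g (h + x) - (f x + g x) - (L1 + L2) h =
    (f (h + x) - f x - L1 h) + (g (h + x) - g x - L2 h).
  by rewrite -[(L1 + L2) h]/(L1 h + L2 h) !opprD [RHS]addrACA [X in X + _ = _]addrACA.
rewrite (le_trans (ler_normD _ _)) // (splitr e) mulrDl lerD //; near: h.
  exact: fx.
exact: gx.
Unshelve. all: by end_near. Qed.

Lemma has_frechet_near f g x L : (\forall y \near x, f y = g y) ->
  has_frechet f x L -> has_frechet g x L.
Proof.
move=> fg fx e e0; have fgx : f x = g x by exact: nbhs_singleton fg.
move/nbhs0P: fg => fg.
near=> h.
rewrite -fgx; have <- : f (h + x) = g (h + x) by rewrite addrC; near: h; exact: fg.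
by near: h; exact: fx.
Unshelve. all: by end_near. Qed.

Lemma has_frechet_cst (w : W) x : has_frechet (fun=> w) x 0.
Proof.
move=> e e0; apply: nearW => h; rewrite subrr -[X in _ - X]/(0 : W) subr0 normr0.
by rewrite mulr_ge0 // ltW.
Qed.

End Frechet.

(** * Bounded bilinear maps and their operator-valued lifts *)

Definition bounded_bilinear (R : realType) (W1 W2 W : normedModType R) (B : W1 -> W2 -> W) :=
  [/\ forall w, linear (fun u => B u w), forall u, linear (B u) &
    exists2 C : R, 0 <= C & forall u w, `|B u w| <= C * `|u| * `|w|].

Section Bilinear.
Variables (R : realType) (W1 W2 W : normedModType R).
Implicit Types (B : W1 -> W2 -> W).

Lemma bounded_bilinear_flip B : bounded_bilinear B -> bounded_bilinear (fun w u => B u w).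
Proof. by move=> [l1 l2 [C C0 BC]]; split=> //; exists C => // u w; rewrite mulrAC. Qed.

Variable V : normedModType R.

(** The shape of each term of the product rule. The default 0 of [insubd] is never taken for a
    bounded bilinear [B], by [bicompE]. *)
Definition bicomp B (u : W1) (L : clin V W2) : clin V W := insubd 0 (fun v => B u (L v)).

Lemma bicompE B u L v : bounded_bilinear B -> bicomp B u L v = B u (L v).
Proof.
move=> [l1 l2 [C C0 BC]]; rewrite /bicomp -[LHS]/(val _ v) val_insubd ifT //.
apply: (@bounded_is_clin _ _ _ _ (C * `|u| * `|L|)) => [a x y|x].
  by rewrite clin_linear l2.
by rewrite (le_trans (BC _ _)) // -!mulrA !ler_wpM2l // ler_opnorm.
Qed.

Lemma bounded_bilinear_bicomp B : bounded_bilinear B -> bounded_bilinear (bicomp B).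
Proof.
move=> hB; have [l1 l2 [C C0 BC]] := hB; split.
- move=> L a u v; apply: val_inj; apply/funext => x /=.
  by rewrite bicompE // l1 -!bicompE.
- move=> u a L M; apply: val_inj; apply/funext => x /=.
  rewrite bicompE // -[(a *: L + M) x]/(a *: L x + M x) l2 -!bicompE //.
exists C => // u L; apply: clin_norm_le => [|x]; first by rewrite !mulr_ge0.
by rewrite bicompE // (le_trans (BC _ _)) // -!mulrA !ler_wpM2l // ler_opnorm.
Qed.

End Bilinear.

(** * Product rule and stability of the classes [Ck_on] *)

Section CkOn.
Variables (R : realType).
Implicit Types (V W : normedModType R).

(** Supplies radii in estimates whose coefficient may vanish, hence the division by [1 + a]. *)
Lemma exists_mulr_le (a e : R) : 0 <= a -> 0 < e -> exists2 d, 0 < d & a * d <= e.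
Proof.
move=> a0 e0; have a1 : 0 < 1 + a by rewrite ltr_pwDl.
exists (e / (1 + a)); first by rewrite divr_gt0.
by rewrite mulrA ler_pdivrMr // mulrDr mulr1 [e * a]mulrC lerDr ltW.
Qed.

Lemma linear_sub V W (f : V -> W) : linear f -> forall x y, f (x - y) = f x - f y.
Proof. by move=> lf x y; rewrite [x - y]addrC -scaleN1r lf scaleN1r addrC. Qed.

Lemma bilinear_incr W1 W2 W (B : W1 -> W2 -> W) u u' w w' : bounded_bilinear B ->
  B u' w' - B u w = B (u' - u) (w' - w) + B u (w' - w) + B (u' - u) w.
Proof.
move=> [l1 l2 _]; rewrite !(linear_sub (l2 _)) addrAC subrK (linear_sub (l1 _)).
by rewrite addrA subrK.
Qed.

Lemma has_frechet_bilin V W1 W2 W (B : W1 -> W2 -> W) (f : V -> W1) (g : V -> W2) x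
    (L : clin V W1) (M : clin V W2) : bounded_bilinear B ->
  has_frechet f x L -> has_frechet g x M ->
  has_frechet (fun y => B (f y) (g y)) x
    (bicomp B (f x) M + bicomp (fun w u => B u w) (g x) L).
Proof.
move=> hB fx gx e e0; have [l1 l2 [C C0 BC]] := hB.
have hB' := bounded_bilinear_flip hB.
set u := f x; set w := g x; set K := 1 + `|L|; set K' := 1 + `|M|.
have K0 : 0 <= K by rewrite addr_ge0.
have K'0 : 0 <= K' by rewrite addr_ge0.
have e2 : 0 < e / 2 by rewrite divr_gt0.
(* [d] bounds [|h|] so that the quadratic term, [B] of both increments, takes half of [e]; [e1] is
   the tolerance for the remainders of [f] and [g], which share the other half. *)
have [d d0 dP] := exists_mulr_le (mulr_ge0 C0 (mulr_ge0 K0 K'0)) e2.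
have [e1 e10 e1P] := exists_mulr_le (mulr_ge0 C0 (addr_ge0 (normr_ge0 u) (normr_ge0 w))) e2.
near=> h.
rewrite bilinear_incr // -/u -/w.
have -> : (bicomp B u M + bicomp (fun w u => B u w) w L) h = B u (M h) + B (L h) w.
  by rewrite -[LHS]/(bicomp B u M h + bicomp (fun w u => B u w) w L h) !bicompE.
have -> : B (f (h + x) - u) (g (h + x) - w) + B u (g (h + x) - w) + B (f (h + x) - u) w -
      (B u (M h) + B (L h) w) = B (f (h + x) - u) (g (h + x) - w) +
    (B u (g (h + x) - w - M h) + B (f (h + x) - u - L h) w).
  rewrite (linear_sub (l2 u) _ (M h)) (linear_sub (l1 w) _ (L h)).
  by rewrite [X in _ = _ + X]addrACA -opprD !addrA.
have fh : `|f (h + x) - u| <= K * `|h| by near: h; exact: has_frechet_lip.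
have gh : `|g (h + x) - w| <= K' * `|h| by near: h; exact: has_frechet_lip.
have fh' : `|f (h + x) - u - L h| <= e1 * `|h| by near: h; exact: fx.
have gh' : `|g (h + x) - w - M h| <= e1 * `|h| by near: h; exact: gx.
have hd : `|h| <= d by near: h; exact: nbhs0_le.
have n0 := normr_ge0 h.
rewrite (splitr e) mulrDl (le_trans (ler_normD _ _)) //; apply: lerD.
  apply: (le_trans (BC _ _)).
  apply: (@le_trans _ _ (C * (K * `|h|) * (K' * `|h|))).
    by rewrite -!mulrA ler_wpM2l // mulrA ler_pM.
  have -> : C * (K * `|h|) * (K' * `|h|) = C * (K * K') * `|h| * `|h| by ring.
  by rewrite ler_wpM2r // (le_trans _ dP) // ler_wpM2l // !mulr_ge0.
apply: (le_trans (ler_normD _ _)).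
apply: (@le_trans _ _ (C * `|u| * (e1 * `|h|) + C * (e1 * `|h|) * `|w|)).
  apply: lerD; apply: (le_trans (BC _ _)); first by rewrite ler_wpM2l // mulr_ge0.
  by rewrite ler_wpM2r // ler_wpM2l.
have -> : C * `|u| * (e1 * `|h|) + C * (e1 * `|h|) * `|w| =
  C * (`|u| + `|w|) * e1 * `|h| by ring.
by rewrite ler_wpM2r.
Unshelve. all: by end_near. Qed.

Lemma bilin_continuous V W1 W2 W (B : W1 -> W2 -> W) (f : V -> W1) (g : V -> W2) x :
  bounded_bilinear B -> {for x, continuous f} -> {for x, continuous g} ->
  {for x, continuous (fun y => B (f y) (g y))}.
Proof.
move=> hB fx gx; have [_ _ [C C0 BC]] := hB.
apply/cvgrPdistC_le => e e0.
have [d d0 dP] := exists_mulr_le (mulr_ge0 C0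
  (addr_ge0 (addr_ge0 ler01 (normr_ge0 (f x))) (normr_ge0 (g x)))) e0.
(* The cap at 1 makes the term quadratic in [d'] at most linear. *)
pose d' := Num.min 1 d.
have d'0 : 0 < d' by rewrite lt_min ltr01.
near=> y.
have fy : `|f y - f x| <= d' by near: y; move/cvgrPdistC_le: fx; apply.
have gy : `|g y - g x| <= d' by near: y; move/cvgrPdistC_le: gx; apply.
rewrite bilinear_incr // (le_trans (ler_normD _ _)) //.
apply: (@le_trans _ _ (C * d' * 1 + C * `|f x| * d' + C * d' * `|g x|)).
  apply: lerD; last by rewrite (le_trans (BC _ _)) // ler_wpM2r // ler_wpM2l.
  apply: (le_trans (ler_normD _ _)); apply: lerD; apply: (le_trans (BC _ _)).
    rewrite ler_pM // ?mulr_ge0 // ?ler_wpM2l // (le_trans gy) //.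
    by rewrite ge_min lexx.
  by rewrite ler_wpM2l // mulr_ge0.
apply: le_trans dP.
have -> : C * d' * 1 + C * `|f x| * d' + C * d' * `|g x| =
  C * (1 + `|f x| + `|g x|) * d' by ring.
rewrite ler_wpM2l ?mulr_ge0 ?addr_ge0 // ge_min lexx orbT //.
Unshelve. all: by end_near. Qed.

Section FixedDomain.
Variables (V : normedModType R) (U : set V).
Hypothesis oU : open U.

Lemma near_open x (P : V -> Prop) : U x -> (forall y, U y -> P y) -> \forall y \near x, P y.
Proof. by move=> Ux UP; apply: filterS UP _; exact: open_nbhs_nbhs. Qed.

Lemma has_frechet_continuous W (f : V -> W) x L : has_frechet f x L -> {for x, continuous f}.
Proof. by move=> /has_frechetP[df _]; exact: differentiable_continuous. Qed.

(** A derivative depends only on the germ of a map, so on an open set the equality passes to the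
    derivatives and the induction goes on. *)
Lemma Ck_on_eq k W (f g : V -> W) : (forall x, U x -> f x = g x) ->
  Ck_on k U f -> Ck_on k U g.
Proof.
elim: k W f g => [|k IH] W f g fg /=.
  move=> fc x Ux; rewrite /prop_for /continuous_at -fg //.
  by apply: cvg_trans (fc x Ux); apply: near_eq_cvg; exact: near_open.
move=> [df Df].
have D x : U x -> has_frechet g x (frechet f x).
  move=> Ux; apply: (@has_frechet_near _ _ _ f); first exact: near_open.
  by apply/has_frechetP; split=> //; exact: df.
split=> [x /D/has_frechetP[] //|]; apply: IH Df => x /D/has_frechetP[_ ->] //.
Qed.

(** Lets an explicit formula [D] replace [frechet f], whatever the latter is outside [U]. *)
Lemma Ck_onS k W (f : V -> W) : Ck_on k.+1 U f <->
  exists2 D, Ck_on k U D & forall x, U x -> has_frechet f x (D x).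
Proof.
split=> [[df Df]|[D Dk fD]].
  by exists (frechet f) => // x Ux; apply/has_frechetP; split=> //; exact: df.
split=> [x /fD/has_frechetP[] //|]; apply: Ck_on_eq Dk => x /fD/has_frechetP[_ ->] //.
Qed.

Lemma Ck_onW k W (f : V -> W) : Ck_on k.+1 U f -> Ck_on k U f.
Proof.
elim: k W f => [|k IH] W f /Ck_onS[D Dk fD].
  by move=> x /fD/has_frechet_continuous.
by apply/Ck_onS; exists D => //; exact: IH.
Qed.

Lemma Ck_on_cst k W (w : W) : Ck_on k U (fun=> w).
Proof.
elim: k W w => [|k IH] W w; first by move=> x _; exact: cst_continuous.
by apply/Ck_onS; exists (fun=> 0) => // x _; exact: has_frechet_cst.
Qed.

Lemma Ck_onD k W (f g : V -> W) : Ck_on k U f -> Ck_on k U g ->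
  Ck_on k U (fun x => f x + g x).
Proof.
elim: k W f g => [|k IH] W f g.
  by move=> fc gc x Ux; apply: cvgD; [exact: fc|exact: gc].
move=> /Ck_onS[D Dk fD] /Ck_onS[E Ek gE]; apply/Ck_onS.
exists (fun x => D x + E x); first exact: IH.
by move=> x Ux; apply: has_frechetD; [exact: fD|exact: gE].
Qed.

(** The product rule expresses the derivative by the lifts [bicomp], again bounded bilinear, so the
    induction must range over all spaces and all [B]. *)
Lemma Ck_on_bilin k W1 W2 W (B : W1 -> W2 -> W) (f : V -> W1) (g : V -> W2) :
  bounded_bilinear B -> Ck_on k U f -> Ck_on k U g -> Ck_on k U (fun x => B (f x) (g x)).
Proof.
elim: k W1 W2 W B f g => [|k IH] W1 W2 W B f g hB.
  by move=> fc gc x Ux; apply: bilin_continuous; [|exact: fc|exact: gc].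
move=> fk gk; have fk' := Ck_onW fk; have gk' := Ck_onW gk.
move: fk gk => /Ck_onS[D Dk fD] /Ck_onS[E Ek gE]; apply/Ck_onS.
exists (fun x => bicomp B (f x) (E x) + bicomp (fun w u => B u w) (g x) (D x)).
  apply: Ck_onD; apply: IH => //; apply: bounded_bilinear_bicomp => //.
  exact: bounded_bilinear_flip.
by move=> x Ux; apply: has_frechet_bilin; [|exact: fD|exact: gE].
Qed.

(* A solution of the differential equation [f' = B (f, f)] is smooth: each
   derivative of [f] is as regular as [f] itself. *)
Lemma smooth_on_bilin_ode W (B : W -> W -> clin V W) (f : V -> W) : bounded_bilinear B ->
  (forall x, U x -> has_frechet f x (B (f x) (f x))) -> smooth_on U f.
Proof.
move=> hB fB; elim=> [|k IH]; first by move=> x /fB/has_frechet_continuous.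
by apply/Ck_onS; exists (fun x => B (f x) (f x)) => //; exact: Ck_on_bilin.
Qed.

End FixedDomain.
End CkOn.

(** * Smoothness of the resolvent, and openness of the two domains *)

Section CayleySmooth.
Variables (R : realType) (A : cStarAlgType R).
Local Notation AR := (realification A).
Implicit Types (c : R[i]).

(** [M] is the modulus of [c] as an element of [R], whereas [|c|] lives in [R[i]]. *)
Lemma anormZ_real c : exists2 M : R, 0 <= M & forall x : A, anorm (c *: x) = M * anorm x.
Proof.
exists (Num.sqrt (complex.Re c ^+ 2 + complex.Im c ^+ 2)) => [|x]; first exact: sqrtr_ge0.
by apply: (@complexI R); rewrite anormZ normc_def rmorphM.
Qed.

Lemma bounded_bilinear_mul : bounded_bilinear (fun p q : AR => (p : A) * (q : A) : AR).
Proof.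
split=> [w a u v|w a u v|]; last by exists 1 => // u w; rewrite mul1r; exact: anormM.
  rewrite -[LHS]/((a%:C *: (u : A) + v) * (w : A)).
  by rewrite mulrDl -scalerAl.
rewrite -[LHS]/((w : A) * (a%:C *: (u : A) + v)).
by rewrite mulrDr -scalerAr.
Qed.

(* The derivative of [x |-> (1 + c *: x)^-1] is [inv_diff c p p] with [p] its value. *)
Definition inv_diff c (p q : AR) : clin AR AR :=
  insubd 0 (fun v : AR => - ((p : A) * (c *: (v : A)) * (q : A)) : AR).

Lemma inv_diffE c (p q v : AR) : inv_diff c p q v = - ((p : A) * (c *: (v : A)) * (q : A)).
Proof.
have [M M0 cM] := anormZ_real c.
rewrite /inv_diff -[LHS]/(val _ v) val_insubd ifT //.
apply: (@bounded_is_clin _ _ _ _ (anorm (p : A) * M * anorm (q : A))) => [a x y|x].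
  rewrite -[LHS]/(- ((p : A) * (c *: (a%:C *: (x : A) + y)) * (q : A))).
  rewrite -[RHS]/(a%:C *: (- ((p : A) * (c *: (x : A)) * (q : A)))
    - ((p : A) * (c *: (y : A)) * (q : A))).
  rewrite scalerDr mulrDr mulrDl opprD scalerA [c * _]mulrC -scalerA.
  by rewrite -scalerAr -scalerAl scalerN.
rewrite -[leLHS]/(anorm (- ((p : A) * (c *: (x : A)) * (q : A)))) -[`|x|]/(anorm (x : A)).
rewrite anormN (le_trans (anormM _ _)) // mulrAC ler_wpM2r ?anorm_ge0 //.
by rewrite (le_trans (anormM _ _)) // cM mulrA.
Qed.

Lemma bounded_bilinear_inv_diff c : bounded_bilinear (inv_diff c).
Proof.
have [M M0 cM] := anormZ_real c; split.
- move=> w a u v; apply: val_inj; apply/funext => x /=.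
  rewrite -[RHS]/(a%:C *: (inv_diff c u w x : A) + (inv_diff c v w x : A)) !inv_diffE.
  rewrite -[X in - (X * _ * _)]/(a%:C *: (u : A) + v).
  by rewrite !mulrDl -!scalerAl opprD scalerN.
- move=> w a u v; apply: val_inj; apply/funext => x /=.
  rewrite -[RHS]/(a%:C *: (inv_diff c w u x : A) + (inv_diff c w v x : A)) !inv_diffE.
  rewrite -[X in - (_ * _ * X)]/(a%:C *: (u : A) + v).
  by rewrite !mulrDr -!scalerAr opprD scalerN.
exists M => // u w; apply: clin_norm_le => [|x]; first by rewrite !mulr_ge0.
rewrite inv_diffE -[leLHS]/(anorm (- ((u : A) * (c *: (x : A)) * (w : A)))).
rewrite anormN (le_trans (anormM _ _)) // [leRHS]mulrAC ler_wpM2r ?anorm_ge0 //.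
by rewrite (le_trans (anormM _ _)) // cM mulrCA mulrA.
Qed.

(** The resolvent identity [w' - w = - w' (c h) w], used twice, turns the remainder into
    [w' (c h) w (c h) w], which is quadratic in [h] as soon as [|w'| <= 2 |w|]. *)
Lemma has_frechet_inv c (x : AR) :
  (\forall y \near x, 1 + c *: (y : A) \is a GRing.unit) ->
  has_frechet (fun y : AR => (1 + c *: (y : A))^-1 : AR) x
    (inv_diff c (1 + c *: (x : A))^-1 (1 + c *: (x : A))^-1).
Proof.
have half (a b t : R) : a <= b + t -> t <= a * 2^-1 -> a <= 2 * b by lra.
move=> near_unit e e0; have [M M0 cM] := anormZ_real c.
have yu : 1 + c *: (x : A) \is a GRing.unit by exact: nbhs_singleton near_unit.
set w := (1 + c *: (x : A))^-1; have w0 : 0 <= anorm w := anorm_ge0 w.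
(* [|h| <= d] gives [M |w| |h| <= 1/2], hence [|w'| <= 2 |w|]; [|h| <= d'] then gives
   [2 M^2 |w|^3 |h| <= e]. *)
have [d d0 dP] := exists_mulr_le (mulr_ge0 M0 w0) (ltac:(lra) : 0 < 2^-1 :> R).
have [d' d'0 d'P] := exists_mulr_le
  (mulr_ge0 (mulr_ge0 (ler0n R 2) (exprn_ge0 2 M0)) (exprn_ge0 3 w0)) e0.
move/nbhs0P: near_unit => near_unit.
apply: filterS3 near_unit (@nbhs0_le R AR d d0) (@nbhs0_le R AR d' d'0) => h y'u hd hd'.
rewrite [x + h]addrC in y'u.
rewrite inv_diffE; set w' := (1 + c *: (h + x : A))^-1.
have n0 : 0 <= anorm (h : A) := anorm_ge0 _.
have nw' : 0 <= anorm w' := anorm_ge0 _.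
have dw : w' - w = - (w' * (c *: (h : A)) * w).
  have -> : c *: (h : A) = (1 + c *: (h + x : A)) - (1 + c *: (x : A)).
    by rewrite scalerDr addrCA addrK.
  by rewrite mulrBr mulVr // mulrBl mul1r mulrK // opprB.
have nch (a b : A) : anorm (a * (c *: (h : A)) * b) <= anorm a * (M * anorm (h : A)) * anorm b.
  rewrite (le_trans (anormM _ _)) // ler_wpM2r ?anorm_ge0 //.
  by rewrite (le_trans (anormM _ _)) // cM.
have w'w : anorm w' <= 2 * anorm w.
  have : anorm w' <= anorm w + anorm w' * (M * anorm (h : A)) * anorm w.
    rewrite -[X in anorm X <= _](subrK w) addrC dw (le_trans (anormB _ _)) //.
    by rewrite lerD2l.
  have : anorm w' * (M * anorm (h : A)) * anorm w <= anorm w' * 2^-1.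
    rewrite -mulrA ler_wpM2l // (le_trans _ dP) // mulrAC ler_wpM2l ?mulr_ge0 //.
  by move=> ta at2; exact: half at2 ta.
have -> : w' - w - - (w * (c *: (h : A)) * w) = w' * (c *: (h : A)) * w * (c *: (h : A)) * w.
  by rewrite {1}dw opprK addrC -!mulrBl -opprB dw opprK.
set ch := c *: (h : A) in nch *.
have goal : anorm (w' * ch * w * ch * w) <= e * anorm (h : A); last exact: goal.
apply: (le_trans (nch _ _)); rewrite mulrAC -mulrA.
apply: (@le_trans _ _
    (2 * anorm w * (M * anorm (h : A)) * anorm w * (anorm w * (M * anorm (h : A))))).
  rewrite ler_wpM2r ?mulr_ge0 // (le_trans (nch _ _)) // ler_wpM2r // ler_wpM2r //.
  exact: mulr_ge0.
have -> : 2 * anorm w * (M * anorm (h : A)) * anorm w * (anorm w * (M * anorm (h : A))) =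
  2 * M ^+ 2 * anorm w ^+ 3 * anorm (h : A) * anorm (h : A) by ring.
by rewrite ler_wpM2r // (le_trans _ d'P) // ler_wpM2l // !mulr_ge0 // exprn_ge0.
Qed.

(** Accretivity is a strict norm inequality and multiplication by ['i] is isometric, so the same [m]
    works near [h]. *)
Lemma open_halfspace : open (@halfspace R A : set AR).
Proof.
rewrite openE => h /halfspaceE[m hm]; apply/nbhs_ballP.
exists (m - anorm (m%:C%:A - - ('i *: (h : A)))); first by rewrite /= subr_gt0.
move=> k; rewrite -ball_normE /= => hk; apply/halfspaceE; exists m.
have -> : m%:C%:A - - ('i *: (k : A)) = (m%:C%:A - - ('i *: (h : A))) - 'i *: ((h : A) - k).
  by rewrite !opprK scalerBr opprB addrA [RHS]addrAC addrK.
apply: (le_lt_trans (anormB _ _)); rewrite anormi.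
by rewrite -ltrBrDl.
Qed.

Lemma open_disc : open (@disc R A : set AR).
Proof.
rewrite openE => z /= z1; apply/nbhs_ballP.
exists (1 - anorm (z : A)); first by rewrite /= subr_gt0.
move=> k; rewrite -ball_normE /= => zk; rewrite /disc /=.
have -> : (k : A) = (z : A) - ((z : A) - k) by rewrite subKr.
by apply: (le_lt_trans (anormB _ _)); rewrite -ltrBrDl.
Qed.

Lemma smooth_on_inv c (U : set AR) (a b : A) (f : AR -> AR) : open U ->
  (forall x : A, U x -> 1 + c *: x \is a GRing.unit) ->
  (forall x : A, U x -> f x = a * (1 + c *: x)^-1 + b) -> smooth_on U f.
Proof.
move=> oU uU fE k.
pose g : AR -> AR := fun x : AR => (1 + c *: (x : A))^-1.
have gs : Ck_on k U g.
  apply: smooth_on_bilin_ode => //; first exact: (bounded_bilinear_inv_diff c).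
  by move=> x Ux; apply: has_frechet_inv; apply: near_open Ux _.
apply: (@Ck_on_eq _ _ U oU k _ (fun x => (a * (g x : A) : AR) + (b : AR))).
  by move=> x /fE.
apply: Ck_onD => //; last exact: Ck_on_cst.
by apply: (Ck_on_bilin oU bounded_bilinear_mul) => //; exact: Ck_on_cst.
Qed.

End CayleySmooth.

Theorem theorem7p5 (R : realType) (A : cStarAlgType R) :
  (forall h : A, halfspace h -> 1 - 'i *: h \is a GRing.unit) /\
  (forall z : A, disc z -> 1 + z \is a GRing.unit) /\
  diffeomorphism
    (@halfspace R A : set (realification A)) (@disc R A : set (realification A))
    (@Gamma R A) (@Gamma_inv R A).
Proof.
split; first exact: halfspace_unit.
split; first exact: disc_unit.
split.
- by split; [exact: open_halfspace|exact: open_disc].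
- by split; [exact: Gamma_disc|exact: Gamma_inv_halfspace].
- by split=> x /set_mem; [exact: GammaK|exact: Gamma_invK].
(* The coefficients are read off [GammaE] here and off [Gamma_invE] in the next case. *)
- apply: (@smooth_on_inv _ _ (- 'i) _ 2%:C%:A (- 1) _ (@open_halfspace R A)) => h hh.
    by rewrite scaleNr; exact: halfspace_unit.
  by rewrite scaleNr -scalerAl mul1r GammaE //; exact: halfspace_unit.
- apply: (@smooth_on_inv _ _ 1 _ ('i * 2%:C)%:A (- 'i%:A) _ (@open_disc R A)) => z zz.
    by rewrite scale1r; exact: disc_unit.
  by rewrite scale1r -scalerAl mul1r Gamma_invE ?scalerBr ?scalerA //; exact: disc_unit.
Qed.
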